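(* For every integer $n > 1$, stit logic does not have the Strong Restricted $n$-Craig Interpolation Property $(SRCIP)_n$; that is, there exist a set of propositional variables $V$ and formulas $A, B \in \mathcal{L}^{\{1,\ldots,n\}}_V$ with $\vdash A \to B$ and $Ag(A)\cap Ag(B) = \emptyset$ such that there is no $C \in \mathcal{L}^{\emptyset}_{|A|\cap|B|}$ (i.e. no formula over the shared variables containing no action modalities $[j]$) with both $\vdash A \to C$ and $\vdash C \to B$.
   Context: For a finite set $Ag$ of agent indices (possibly empty) and a set $V$ of propositional variables, $\mathcal{L}^{Ag}_V$ is the set of stit formulas given by $A ::= p \mid A \to A \mid \bot \mid \Box A \mid [j]A$ with $p \in V$, $j \in Ag$ (other Boolean connectives defined as usual; $\Diamond A := \neg\Box\neg A$); $\mathcal{L}^{\emptyset}_V$ contains no action modalities. $\vdash A$ means derivability in the axiom system $\mathbb{S}$ with axioms: all classical propositional tautologies; S5 axioms for $\Box$ and for each $[j]$; $\Box A \to [j]A$; and $(\Diamond[j_1]A_1 \wedge\dots\wedge \Diamond[j_k]A_k) \to \Diamond([j_1]A_1\wedge\dots\wedge[j_k]A_k)$ for pairwise distinct $j_1,\dots,j_k$; rules: modus ponens and necessitation for $\Box$. (This system is sound and strongly complete for the standard branching-time stit semantics.) For a formula $A$, $|A|$ is the set of propositional variables occurring in $A$ and $Ag(A)$ the set of agent indices occurring in $A$. *)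

(* Defs.v *)
From mathcomp Require Import all_boot.
From mathcomp Require Import classical_sets.

Set Implicit Arguments.
Unset Strict Implicit.
Unset Printing Implicit Defensive.

Local Open Scope classical_set_scope.

(* [form Ag V] is the language L^Ag_V. *)
Inductive form (Ag V : Type) : Type :=
| Var of V
| Imp of form Ag V & form Ag V
| Bot
| Box of form Ag V
| Stit of Ag & form Ag V.

Arguments Bot {Ag V}.
Arguments Var {Ag V} _.

Section Formulas.
Variables Ag V : Type.
Implicit Types A B : form Ag V.

Definition Neg A := Imp A Bot.
Definition And A B := Neg (Imp A (Neg B)).
Definition Dia A := Neg (Box (Neg A)).

(* Conjunction of the nonempty list A :: s, without a trailing Top. *)
Fixpoint conj A (s : seq (form Ag V)) : form Ag V :=
  if s is B :: s' then And A (conj B s') else A.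

(* The set |A|. *)
Fixpoint vars A : set V :=
  match A with
  | Var p => [set p]
  | Imp B C => vars B `|` vars C
  | Bot => set0
  | Box B => vars B
  | Stit _ B => vars B
  end.

(* The set Ag(A). *)
Fixpoint agents A : set Ag :=
  match A with
  | Var _ => set0
  | Imp B C => agents B `|` agents C
  | Bot => set0
  | Box B => agents B
  | Stit j B => j |` agents B
  end.

(* For G and W subsets of Ag and V, L^G_W as a sublanguage of L^Ag_V. *)
Definition sublang (G : set Ag) (W : set V) : set (form Ag V) :=
  [set A | agents A `<=` G /\ vars A `<=` W].

(* Variables and modal formulas alike are atoms for the Boolean valuation v. *)
Fixpoint truth (v : form Ag V -> bool) A : bool :=
  match A with
  | Imp B C => truth v B ==> truth v C
  | Bot => false
  | _ => v A
  end.

Definition tautology A : Prop := forall v, truth v A.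

Inductive S5_axiom (M : form Ag V -> form Ag V) : form Ag V -> Prop :=
| S5_K A B : S5_axiom M (Imp (M (Imp A B)) (Imp (M A) (M B)))
| S5_T A : S5_axiom M (Imp (M A) A)
| S5_4 A : S5_axiom M (Imp (M A) (M (M A)))
| S5_5 A : S5_axiom M (Imp (Neg (M A)) (M (Neg (M A)))).

End Formulas.

Section Derivability.
Variables (Ag : finType) (V : Type).

Inductive derivable : form Ag V -> Prop :=
| D_taut A : tautology A -> derivable A
| D_box A : S5_axiom (@Box Ag V) A -> derivable A
| D_stit j A : S5_axiom (Stit j) A -> derivable A
| D_incl j A : derivable (Imp (Box A) (Stit j A))
| D_indep j A (s : seq (Ag * form Ag V)) :
    uniq (j :: [seq x.1 | x <- s]) ->
    derivable
      (Imp (conj (Dia (Stit j A)) [seq Dia (Stit x.1 x.2) | x <- s])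
           (Dia (conj (Stit j A) [seq Stit x.1 x.2 | x <- s])))
| D_mp A B : derivable (Imp A B) -> derivable A -> derivable B
| D_nec A : derivable A -> derivable (Box A).

End Derivability.

(* Main.v *)
Require Import Defs.
From mathcomp Require Import all_boot.
From mathcomp Require Import boolp classical_sets.

Set Implicit Arguments.
Unset Strict Implicit.
Unset Printing Implicit Defensive.

Local Open Scope classical_set_scope.

(** Take A := <>[i]p and B := ~<>[j]~p with i and j distinct. By independence
    of agents, <>[i]p and <>[j]~p would yield <>([i]p /\ [j]~p), which is
    absurd; hence |- A -> B. Now consider one moment with two histories, p
    true on exactly one of them, where a single agent, the dictator,
    determines the history and the choices of all others are vacuous. Under
    the dictatorship of i, A says <>p and holds; under that of j, B says ~<>~p
    and fails. A formula without action modalities cannot tell the two apart,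
    so it cannot interpolate. *)

Section Satisfaction.
Context {Ag V W : Type}.
Implicit Types (c : Ag -> rel W) (v : V -> pred W) (A B : form Ag V).

(* Without tenses a single moment suffices: [W] is the set of histories through
   it, and [c j w] is the choice cell of agent [j] that contains [w]. *)
Fixpoint sat c v (w : W) A : bool :=
  match A with
  | Var p => v p w
  | Imp B C => sat c v w B ==> sat c v w C
  | Bot => false
  | Box B => `[< forall u, sat c v u B >]
  | Stit j B => `[< forall u, c j w u -> sat c v u B >]
  end.

Definition stit_choice c : Prop :=
  (forall j, equivalence_rel (c j)) /\
  (forall f : Ag -> W, exists u, forall j, c j (f j) u).

Lemma truth_sat c v w A : truth (sat c v w) A = sat c v w A.
Proof. by elim: A => //= B -> C ->. Qed.

Lemma sat_Imp c v w A B :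
  sat c v w (Imp A B) = (sat c v w A ==> sat c v w B).
Proof. by []. Qed.

Lemma sat_Neg c v w A : sat c v w (Neg A) = ~~ sat c v w A.
Proof. exact: implybF. Qed.

Lemma sat_And c v w A B : sat c v w (And A B) = sat c v w A && sat c v w B.
Proof. by rewrite !sat_Neg sat_Imp sat_Neg negb_imply negbK. Qed.

Lemma sat_Dia c v w A : sat c v w (Dia A) = `[< exists u, sat c v u A >].
Proof.
rewrite sat_Neg /=; apply/asboolPn/asboolP=> [/existsNP[u]|[u satA] /(_ u)].
  by rewrite implybF => /negP; rewrite negbK; exists u.
by rewrite satA.
Qed.

Lemma sat_conj c v w A s : sat c v w (conj A s) = all (sat c v w) (A :: s).
Proof.
elim: s A => [|B s IH] A; first by rewrite /= andbT.
by rewrite [conj _ _]/= sat_And IH.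
Qed.

Lemma sat_agents0 c c' v w A :
  agents A `<=` set0 -> sat c v w A = sat c' v w A.
Proof.
elim: A w => //= [B IHB C IHC|B IHB|j B _] w.
- by rewrite subUset => -[/IHB -> /IHC ->].
- by move=> B0; congr asbool; apply: eq_forall => u; rewrite IHB.
- by move=> /(_ j (or_introl erefl)).
Qed.

Section EquivalenceModality.
Variables (c : Ag -> rel W) (v : V -> pred W).
Variables (M : form Ag V -> form Ag V) (e : rel W).
Hypothesis e_equiv : equivalence_rel e.
Hypothesis sat_M :
  forall w A, sat c v w (M A) = `[< forall u, e w u -> sat c v u A >].

Lemma sat_modality_cell w u A : e w u -> sat c v w (M A) = sat c v u (M A).
Proof.
move=> ewu; rewrite !sat_M; congr asbool; apply: eq_forall => t.
by rewrite (e_equiv w u t).2.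
Qed.

Lemma sat_S5_axiom w A : S5_axiom M A -> sat c v w A.
Proof.
case=> {}A => [B|||] /=.
- rewrite !sat_M; apply/implyP => /asboolP satAB.
  apply/implyP => /asboolP satA; apply/asboolP => u ewu.
  exact: implyP (satAB u ewu) (satA u ewu).
- by rewrite sat_M; apply/implyP => /asboolP; apply; rewrite (e_equiv w w w).1.
- apply/implyP => satMA; rewrite sat_M; apply/asboolP => u ewu.
  by rewrite -(sat_modality_cell _ ewu).
- apply/implyP => satNMA; rewrite sat_M; apply/asboolP => u ewu /=.
  by rewrite -(sat_modality_cell _ ewu).
Qed.

End EquivalenceModality.

Lemma sat_Stit_cell c v j w u A :
  equivalence_rel (c j) -> c j w u ->
  sat c v w (Stit j A) = sat c v u (Stit j A).
Proof. by move=> cj_equiv; apply: (sat_modality_cell cj_equiv). Qed.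

End Satisfaction.

Lemma uniq_keys_choice (K : eqType) (T W : Type) (w0 : W)
    (P : K * T -> pred W) (s : seq (K * T)) :
  uniq [seq x.1 | x <- s] -> all (fun x => `[< exists u, P x u >]) s ->
  exists f : K -> W, all (fun x => P x (f x.1)) s.
Proof.
elim: s => [|[k y] s IH] /=; first by exists (fun=> w0).
move=> /andP[ks us] /andP[/asboolP[u Pu] /(IH us)[f Pf]].
exists (fun k' => if k' == k then u else f k').
rewrite eqxx Pu /=.
have s_neq_k : all (fun x => x.1 != k) s.
  by move: ks; rewrite -has_pred1 -all_predC all_map.
have : all (predI (fun x => x.1 != k) (fun x => P x (f x.1))) s.
  by rewrite all_predI s_neq_k.
by apply: sub_all => x /= /andP[/negbTE ->].
Qed.

Section Soundness.
Context {Ag : finType} {V W : Type}.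
Variables (c : Ag -> rel W) (v : V -> pred W).
Hypothesis c_stit : stit_choice c.

Lemma sat_independence w (s : seq (Ag * form Ag V)) :
  uniq [seq x.1 | x <- s] ->
  all (fun x => sat c v w (Dia (Stit x.1 x.2))) s ->
  exists u, all (fun x => sat c v u (Stit x.1 x.2)) s.
Proof.
have [c_equiv c_indep] := c_stit.
move=> us; under eq_all do rewrite sat_Dia.
move=> /(uniq_keys_choice w us)[f satf].
have [u cfu] := c_indep f; exists u; apply: sub_all satf => x.
by rewrite (sat_Stit_cell v _ (c_equiv x.1) (cfu x.1)).
Qed.

Lemma derivable_sat w A : derivable A -> sat c v w A.
Proof.
move=> dA; elim: dA w => {A}
  [A tautA|A axA|j A axA|j A|j A s us|A B _ satAB _ satA|A _ satA] w.
- by rewrite -truth_sat.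
- apply: (@sat_S5_axiom _ _ _ c v (@Box Ag V) (fun _ _ => true)) => // u B.
  by apply/asboolP/asboolP=> satB t => [_|]; apply: satB.
- apply: (@sat_S5_axiom _ _ _ c v (Stit j) (c j)) => //; apply: c_stit.1.
- by apply/implyP => /asboolP satA; apply/asboolP.
- rewrite sat_Imp; apply/implyP.
  rewrite sat_conj sat_Dia -(map_cons (fun x => Dia (Stit x.1 x.2)) (j, A)).
  rewrite all_map => /(sat_independence (s := (j, A) :: s) us)[u satu].
  by apply/asboolP; exists u; rewrite sat_conj -(map_cons _ (j, A)) all_map.
- exact: implyP (satAB w) (satA w).
- exact/asboolP.
Qed.

End Soundness.

Section Dictator.
Context {Ag W : eqType}.

Definition dictator (a j : Ag) : rel W := fun w u => (j == a) ==> (w == u).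

Lemma stit_choice_dictator a : stit_choice (dictator a).
Proof.
rewrite /dictator; split=> [j w u t|f].
  by rewrite eqxx implybT; split=> //; case: (j == a) => //= /eqP ->.
by exists (f a) => j; apply/implyP => /eqP ->.
Qed.

Lemma sat_dictator_Stit (V : Type) (v : V -> pred W) a w A :
  sat (dictator a) v w (Stit a A) = sat (dictator a) v w A.
Proof.
rewrite /= /dictator eqxx; apply/asboolP/idP => [/(_ w)|satA u /eqP <- //].
by apply; rewrite eqxx.
Qed.

Lemma sat_dictator_Dia_Stit (V : Type) (v : V -> pred W) a w A :
  sat (dictator a) v w (Dia (Stit a A)) = sat (dictator a) v w (Dia A).
Proof.
rewrite !sat_Dia; congr asbool; apply: eq_exists => u.
by rewrite sat_dictator_Stit.
Qed.

End Dictator.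

Section Derivations.
Context {Ag : finType} {V : Type}.
Implicit Types A B C : form Ag V.

Lemma derivable_Imp_trans A B C :
  derivable (Imp A B) -> derivable (Imp B C) -> derivable (Imp A C).
Proof.
move=> dAB dBC; apply: D_mp dBC; apply: D_mp dAB; apply: D_taut => v /=.
by case: (truth v A); case: (truth v B); case: (truth v C).
Qed.

Lemma derivable_contra A B :
  derivable (Imp A B) -> derivable (Imp (Neg B) (Neg A)).
Proof.
apply: D_mp; apply: D_taut => v /=.
by case: (truth v A); case: (truth v B).
Qed.

Lemma derivable_Neg_Neg A : derivable (Neg (Neg A)) <-> derivable A.
Proof.
by split; apply: D_mp; apply: D_taut => v /=; case: (truth v A).
Qed.

Lemma derivable_Neg_And A B :
  derivable (Neg (And A B)) <-> derivable (Imp A (Neg B)).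
Proof. exact: derivable_Neg_Neg. Qed.

Lemma derivable_Neg_Dia A : derivable (Neg A) -> derivable (Neg (Dia A)).
Proof. by move=> dNA; apply/derivable_Neg_Neg/D_nec. Qed.

Lemma derivable_incompatible_choices i j A B :
  i != j -> derivable (Imp A (Neg B)) ->
  derivable (Imp (Dia (Stit i A)) (Neg (Dia (Stit j B)))).
Proof.
move=> ij dANB; set X := Stit i A; set Y := Stit j B.
have indep : derivable (Imp (And (Dia X) (Dia Y)) (Dia (And X Y))).
  by apply: (@D_indep _ _ i A [:: (j, B)]); rewrite /= inE ij.
have factive k C : derivable (Imp (Stit k C) C).
  by apply: (@D_stit _ _ k); apply: S5_T.
have incompatible : derivable (Imp X (Neg Y)).
  apply: derivable_Imp_trans (factive i A) _.
  exact: derivable_Imp_trans dANB (derivable_contra (factive j B)).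
have impossible : derivable (Neg (Dia (And X Y))).
  exact/derivable_Neg_Dia/derivable_Neg_And.
by apply/derivable_Neg_And; apply: D_mp (derivable_contra indep) impossible.
Qed.

End Derivations.

Lemma no_agentless_interpolant {Ag : finType} {V W : Type}
    (c c' : Ag -> rel W) (v : V -> pred W) w A B C :
  stit_choice c -> stit_choice c' -> sat c v w A -> ~~ sat c' v w B ->
  agents C `<=` set0 -> derivable (Imp A C) -> ~ derivable (Imp C B).
Proof.
move=> c_stit c'_stit satA nsatB C0 /(derivable_sat v c_stit w).
rewrite sat_Imp satA implyTb (sat_agents0 c c' v w C0) => satC.
move=> /(derivable_sat v c'_stit w).
by rewrite sat_Imp satC implyTb; apply/negP.
Qed.

Theorem theorem4 (n : nat) (hn : 1 < n) :
  exists (V : Type) (A B : form 'I_n V),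
    derivable (Imp A B) /\
    agents A `&` agents B = set0 /\
    ~ (exists C : form 'I_n V,
         sublang set0 (vars A `&` vars B) C /\
         derivable (Imp A C) /\ derivable (Imp C B)).
Proof.
pose i := Ordinal (ltnW hn); pose j := Ordinal hn.
pose p : form 'I_n unit := Var tt.
pose A := Dia (Stit i p); pose B := Neg (Dia (Stit j (Neg p))).
pose val_p : unit -> pred bool := fun=> id.
exists unit, A, B; split; [|split].
- apply: derivable_incompatible_choices => //.
  by apply: D_taut => v /=; case: (v p).
- by rewrite /= !setU0; apply/seteqP; split=> // k [/= -> /(congr1 val)].
have satA : sat (dictator i) val_p true A.
  by rewrite sat_dictator_Dia_Stit sat_Dia; apply/asboolP; exists true.
have nsatB : ~~ sat (dictator j) val_p true B.
  rewrite sat_Neg negbK sat_dictator_Dia_Stit sat_Dia.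
  by apply/asboolP; exists false.
move=> [C [[C0 _] [dAC dCB]]].
exact: (no_agentless_interpolant (stit_choice_dictator i)
  (stit_choice_dictator j) satA nsatB C0 dAC dCB).
Qed.
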